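(* Let $B$ be a biquandle with $\mathcal{Q}(B)=Q$ that is given by a biquandle structure $\{\beta_y\mid y\in Q\}\subset Aut(Q)$. Then $Aut(B)$ is a subgroup of the normalizer of the subset $\{\beta_y\mid y\in Q\}$ in $Aut(Q)$: $$Aut(B)\leq N_{Aut(Q)}\{\beta_y\mid y\in Q\}.$$
   Context: A quandle is a set $Q$ with a binary operation $*$ such that (1) $x*x=x$ for all $x$; (2) for every $y$ the map $S_y(x)=x*y$ is a bijection of $Q$; (3) $(x*y)*z=(x*z)*(y*z)$ for all $x,y,z$. $Aut(Q)$ is the group of bijective quandle homomorphisms $Q\to Q$. A biquandle is a set $B$ with two binary operations $\underline{\ast},\overline{\ast}$ such that (1) $x\,\underline{\ast}\,x=x\,\overline{\ast}\,x$ for all $x$; (2) the maps $\alpha_y(x)=x\,\underline{\ast}\,y$ and $\beta_y(x)=x\,\overline{\ast}\,y$ (for every $y\in B$) are bijections of $B$, and the map $(x,y)\mapsto(y\,\overline{\ast}\,x,\;x\,\underline{\ast}\,y)$ is a bijection of $B\times B$; (3) for all $x,y,z\in B$: $(x\,\underline{\ast}\,y)\,\underline{\ast}\,(z\,\underline{\ast}\,y)=(x\,\underline{\ast}\,z)\,\underline{\ast}\,(y\,\overline{\ast}\,z)$, $(x\,\underline{\ast}\,y)\,\overline{\ast}\,(z\,\underline{\ast}\,y)=(x\,\overline{\ast}\,z)\,\underline{\ast}\,(y\,\overline{\ast}\,z)$, and $(x\,\overline{\ast}\,y)\,\overline{\ast}\,(z\,\overline{\ast}\,y)=(x\,\overline{\ast}\,z)\,\overline{\ast}\,(y\,\underline{\ast}\,z)$.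 $Aut(B)$ is the group of bijections of $B$ preserving both operations. For a biquandle $B=(X,\underline{\ast},\overline{\ast})$, the underlying quandle $\mathcal{Q}(B)=(X,* )$ has operation $x*y=\beta_y^{-1}(x\,\underline{\ast}\,y)$ (this is known to be a quandle). A biquandle structure on a quandle $Q=(X,* )$ is a family of automorphisms $\{\beta_y\mid y\in X\}\subset Aut(Q)$ such that (1) $\beta_{\beta_y(x*y)}\beta_y=\beta_{\beta_x(y)}\beta_x$ for every $x,y\in X$; (2) the map $y\mapsto\beta_y(y)$ is a bijection of $X$. The biquandle given by this structure is $(X,\underline{\ast},\overline{\ast})$ with $x\,\underline{\ast}\,y=\beta_y(x*y)$ and $x\,\overline{\ast}\,y=\beta_y(x)$; its underlying quandle is $Q$. For a group $G$ and a subset $S\subset G$, $N_G(S)=\{g\in G\mid gSg^{-1}=S\}$ is the normalizer of $S$. Both $Aut(B)$ and $Aut(Q)$ are viewed as groups of bijections of the common underlying set $X$. *)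

(* Defs.v *)
From HB Require Import structures.
From mathcomp Require Import all_boot.
From mathcomp Require Import boolp classical_sets.

Set Implicit Arguments.
Unset Strict Implicit.
Unset Printing Implicit Defensive.

Local Open Scope classical_set_scope.

(* The group of bijections of X, which is possibly infinite; the product is
   composition, (f * g) x = f (g x). *)
Record sym (X : Type) := Sym {
  sym_fun :> X -> X;
  sym_bij : bijective sym_fun
}.

Section SymmetricGroup.
Variable X : Type.
Implicit Types f g h : sym X.

Lemma sym_eqP f g : f =1 g -> f = g.
Proof.
case: f g => [f fb] [g gb] /= /funext fg; subst g.
by rewrite (Prop_irrelevance fb gb).
Qed.

Lemma sym_inverse_ex f : exists g : X -> X, cancel f g /\ cancel g f.
Proof. by case: (sym_bij f) => g fK gK; exists g. Qed.

Definition sym_inv_fun f : X -> X := sval (cid (sym_inverse_ex f)).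

Lemma symK f : cancel f (sym_inv_fun f).
Proof. by rewrite /sym_inv_fun; case: cid => g []. Qed.

Lemma sym_invK f : cancel (sym_inv_fun f) f.
Proof. by rewrite /sym_inv_fun; case: cid => g []. Qed.

Definition sym_one : sym X := @Sym X id (inv_bij (fun=> erefl)).

Definition sym_mul f g : sym X := Sym (bij_comp (sym_bij f) (sym_bij g)).

Definition sym_inv f : sym X := Sym (Bijective (sym_invK f) (symK f)).

Lemma sym_mulA : associative sym_mul.
Proof. by move=> f g h; apply: sym_eqP. Qed.

Lemma sym_mul1 : left_id sym_one sym_mul.
Proof. by move=> f; apply: sym_eqP. Qed.

Lemma sym_mulr1 : right_id sym_one sym_mul.
Proof. by move=> f; apply: sym_eqP. Qed.

Lemma sym_mulV : left_inverse sym_one sym_inv sym_mul.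
Proof. by move=> f; apply: sym_eqP => x; apply: symK. Qed.

Lemma sym_mulrV : right_inverse sym_one sym_inv sym_mul.
Proof. by move=> f; apply: sym_eqP => x; apply: sym_invK. Qed.

HB.instance Definition _ := gen_eqMixin (sym X).
HB.instance Definition _ := gen_choiceMixin (sym X).
HB.instance Definition _ :=
  isGroup.Build (sym X) sym_mulA sym_mul1 sym_mulr1 sym_mulV sym_mulrV.

Lemma symM f g x : (f * g)%g x = f (g x). Proof. by []. Qed.

Lemma symVK f : cancel f (f^-1)%g. Proof. exact: symK. Qed.

Lemma symKV f : cancel (f^-1)%g f. Proof. exact: sym_invK. Qed.

End SymmetricGroup.

Section Subgroups.
Local Open Scope group_scope.
Variable G : groupType.
Implicit Types H K S : set G.

(* Meaningful only when K is itself a group: see normalizer_group_closed and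
   quandle_aut_group_closed. In group_closed, closure is under (f, g) |-> f / g. *)
Definition subgroup H K := H `<=` K /\ group_closed [in H].

Definition normalizer H S : set G :=
  [set g | H g /\ [set g * s * g^-1 | s in S] = S].

Lemma normalizer_group_closed H S :
  group_closed [in H] -> group_closed [in normalizer H S].
Proof.
move=> gH; have [H1 HV] := gH; split.
  rewrite inE; split; first by move: H1; rewrite inE.
  rewrite (_ : (fun s => _) = id) ?image_id//.
  by apply/funext => s; rewrite invg1 mul1g mulg1.
move=> f g; rewrite !inE => -[Hf fS] [Hg gS]; split.
  by have := HV f g; rewrite !inE; apply.
rewrite -[in RHS]fS -[X in _ @` X = _]gS [LHS]image_comp.
apply: eq_imagel => s _ /=.
by rewrite invgM invgK !mulgA !mulgVK.
Qed.

End Subgroups.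

Record quandle (X : Type) := Quandle {
  qop : X -> X -> X;
  qop_idem : forall x, qop x x = x;
  qop_bij : forall y, bijective (fun x => qop x y);
  qop_dist : forall x y z, qop (qop x y) z = qop (qop x z) (qop y z)
}.

Definition quandle_aut (X : Type) (Q : quandle X) : set (sym X) :=
  [set f | forall x y, f (qop Q x y) = qop Q (f x) (f y)].

Lemma quandle_aut_group_closed (X : Type) (Q : quandle X) :
  group_closed [in quandle_aut Q].
Proof.
split; first by rewrite inE.
move=> f g; rewrite !inE => fP gP x y; rewrite !symM -fP; congr (f _).
by apply: (can_inj (symVK g)); rewrite gP !symKV.
Qed.

Record biquandle (X : Type) := Biquandle {
  under : X -> X -> X;
  over : X -> X -> X;
  under_over_diag : forall x, under x x = over x x;
  under_bij : forall y, bijective (fun x => under x y);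
  over_bij : forall y, bijective (fun x => over x y);
  switch_bij :
    bijective (fun p : X * X => (over p.2 p.1, under p.1 p.2));
  under_under : forall x y z,
    under (under x y) (under z y) = under (under x z) (over y z);
  under_over : forall x y z,
    over (under x y) (under z y) = under (over x z) (over y z);
  over_over : forall x y z,
    over (over x y) (over z y) = over (over x z) (under y z)
}.

Definition biquandle_aut (X : Type) (B : biquandle X) : set (sym X) :=
  [set f | (forall x y, f (under B x y) = under B (f x) (f y)) /\
           (forall x y, f (over B x y) = over B (f x) (f y))].

Section UnderlyingQuandle.
Variables (X : Type) (B : biquandle X).

Definition over_sym (y : X) : sym X := Sym (over_bij B y).

Definition underlying_op (x y : X) : X := (over_sym y)^-1%g (under B x y).

Let over_op x y : over B (underlying_op x y) y = under B x y.
Proof. exact: (symKV (over_sym y)). Qed.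

Let over_inj y : injective (fun x => over B x y).
Proof. exact: bij_inj (over_bij B y). Qed.

Lemma underlying_op_idem x : underlying_op x x = x.
Proof. by apply: (@over_inj x); rewrite over_op under_over_diag. Qed.

Lemma underlying_op_bij y : bijective (fun x => underlying_op x y).
Proof.
exact: (bij_comp (sym_bij (over_sym y)^-1%g) (under_bij B y)).
Qed.

Let over_morph x y z : over B (underlying_op x y) z =
  underlying_op (over B x z) (over B y z).
Proof.
apply: (@over_inj (over B y z)).
by rewrite over_op over_over over_op under_over.
Qed.

Lemma underlying_op_dist x y z :
  underlying_op (underlying_op x y) z =
  underlying_op (underlying_op x z) (underlying_op y z).
Proof.
apply: (@over_inj z); apply: (@over_inj (under B y z)).
rewrite -[LHS]over_over over_morph over_op over_op.
by rewrite over_morph !over_op under_under.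
Qed.

Definition underlying_quandle : quandle X :=
  Quandle underlying_op_idem underlying_op_bij underlying_op_dist.

End UnderlyingQuandle.

Record biquandle_structure (X : Type) (Q : quandle X) := BiquandleStructure {
  family :> X -> sym X;
  family_aut : forall y, quandle_aut Q (family y);
  family_mul : forall x y,
    (family (family y (qop Q x y)) * family y)%g =
    (family (family x y) * family x)%g;
  family_diag_bij : bijective (fun y => family y y)
}.

Section BiquandleOfStructure.
Variables (X : Type) (Q : quandle X) (beta : biquandle_structure Q).

Definition family_under (x y : X) : X := beta y (qop Q x y).

Definition family_over (x y : X) : X := beta y x.

Lemma family_under_over_diag x : family_under x x = family_over x x.
Proof. by rewrite /family_under qop_idem. Qed.

Lemma family_under_bij y : bijective (fun x => family_under x y).
Proof. exact: (bij_comp (sym_bij (beta y)) (qop_bij Q y)). Qed.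

Lemma family_over_bij y : bijective (fun x => family_over x y).
Proof. exact: (sym_bij (beta y)). Qed.

Let betaM x y z :
  beta (beta y (qop Q x y)) (beta y z) = beta (beta x y) (beta x z).
Proof. exact: (congr1 (fun f : sym X => f z) (family_mul beta x y)). Qed.

Let beta_op x y z : beta x (qop Q y z) = qop Q (beta x y) (beta x z).
Proof. exact: (family_aut beta x). Qed.

Let beta_inj x : injective (beta x).
Proof. exact: bij_inj (sym_bij (beta x)). Qed.

(* With a = beta x y and b = beta y (x * y), both members of the second
   axiom of a structure are the same map, whose values at x and y give this
   identity; it determines x, then y, from (a, b), and b from (a, x). *)
Let switch_key x y :
  qop Q (beta (beta x y) (beta x x)) (beta (beta x y) (beta x y)) =
  beta (family_under x y) (family_under x y).
Proof. by rewrite -!beta_op -betaM. Qed.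

Lemma family_switch_bij :
  bijective (fun p : X * X => (family_over p.2 p.1, family_under p.1 p.2)).
Proof.
have [pi piK piKV] := family_diag_bij beta.
pose S y := @Sym X _ (qop_bij Q y).
have SK u v : (S v)^-1%g (qop Q u v) = u := symVK (S v) u.
pose inv_x (a b : X) := pi ((beta a)^-1%g ((S (beta a a))^-1%g (beta b b))).
exists (fun p => let x := inv_x p.1 p.2 in (x, (beta x)^-1%g p.1)).
  move=> [x y] /=; rewrite /family_over.
  suff -> : inv_x (beta x y) (family_under x y) = x by rewrite symK.
  rewrite /inv_x -switch_key; set a := beta x y.
  by rewrite SK symVK piK.
move=> [a b] /=; set x := inv_x a b; rewrite /family_over sym_invK.
congr pair; set y := sym_inv_fun _ a.
have xy : beta x y = a by rewrite sym_invK.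
apply: (can_inj piK); rewrite /= -switch_key xy.
have -> : beta x x = (beta a)^-1%g ((S (beta a a))^-1%g (beta b b)).
  exact: piKV.
rewrite symKV.
exact: (symKV (S (beta a a))).
Qed.

Lemma family_under_under x y z :
  family_under (family_under x y) (family_under z y) =
  family_under (family_under x z) (family_over y z).
Proof.
rewrite /family_under /family_over -!beta_op -qop_dist.
by rewrite betaM.
Qed.

Lemma family_under_over x y z :
  family_over (family_under x y) (family_under z y) =
  family_under (family_over x z) (family_over y z).
Proof. by rewrite /family_under /family_over betaM beta_op. Qed.

Lemma family_over_over x y z :
  family_over (family_over x y) (family_over z y) =
  family_over (family_over x z) (family_under y z).
Proof. by rewrite /family_under /family_over betaM. Qed.

Definition biquandle_of_structure : biquandle X :=
  Biquandle family_under_over_diag family_under_bij family_over_bij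
    family_switch_bij family_under_under family_under_over family_over_over.

Lemma underlying_quandle_of_structure :
  underlying_quandle biquandle_of_structure = Q.
Proof.
have eqop : qop (underlying_quandle biquandle_of_structure) = qop Q.
  by apply/funext => x; apply/funext => y; apply: (symK (over_sym _ y)).
move: (underlying_quandle _) eqop => [op i b d] /=; case: Q => op' i' b' d' /= e.
by subst op; congr Quandle; apply: Prop_irrelevance.
Qed.

End BiquandleOfStructure.

(* Main.v *)
Require Import Defs.
From mathcomp Require Import all_boot.
From mathcomp Require Import boolp classical_sets.

(** That [f] preserves [over] means [f (beta y x) = beta (f y) (f x)], so conjugation by [f] sends
    [beta y] to [beta (f y)] ([biquandle_aut_conj_family]). As [f] is a bijection of the indices,
    the set of all [beta y] is mapped onto itself. That [f] lies in Aut(Q) holds because the quandle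
    operation is defined from [under] and [over]. *)

Lemma biquandle_aut_group_closed (X : Type) (B : biquandle X) :
  group_closed [in biquandle_aut B].
Proof.
split; first by rewrite inE.
move=> f g; rewrite !inE => -[fu fo] [gu go].
split=> x y; rewrite !symM -?fu -?fo; congr (f _);
  by apply: (can_inj (symVK g)); rewrite ?gu ?go !symKV.
Qed.

(** The product of [x] and [y] in the underlying quandle is the only [u] with
    [over u y = under x y], and [f] carries this equation to the one for [f x] and [f y]. *)
Lemma biquandle_aut_sub_quandle_aut (X : Type) (B : biquandle X) :
  subset (biquandle_aut B) (quandle_aut (underlying_quandle B)).
Proof.
have overK x y :
    Defs.over B (qop (underlying_quandle B) x y) y = Defs.under B x y.
  exact: (symKV (over_sym B y)).
move=> f [fu fo] x y; apply: (bij_inj (over_bij B (f y))).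
by rewrite -fo !overK fu.
Qed.

Lemma biquandle_aut_conj_family (X : Type) (Q : quandle X)
    (beta : biquandle_structure Q) (f : sym X) (y : X) :
  biquandle_aut (biquandle_of_structure beta) f ->
  (f * beta y * f^-1)%g = beta (f y).
Proof.
move=> [_ fo]; apply: sym_eqP => x; rewrite !symM.
by have /= := fo ((f^-1)%g x) y; rewrite /family_over symKV.
Qed.

Theorem theorem3p1 (X : Type) (Q : quandle X) (beta : biquandle_structure Q)
    (B : biquandle X) (QB : underlying_quandle B = Q)
    (Bbeta : B = biquandle_of_structure beta) :
  subgroup (biquandle_aut B) (normalizer (quandle_aut Q) (range beta)).
Proof.
split; last exact: biquandle_aut_group_closed.
move=> f fB; split; first by rewrite -QB; apply: biquandle_aut_sub_quandle_aut.
rewrite Bbeta in fB; apply/seteqP; split=> [_ [_ [y _ <-] <-]|_ [y _ <-]].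
  by rewrite biquandle_aut_conj_family//; exists (f y).
(* The normalizer asks for equality of sets, so each [beta y] must be a conjugate: of the member
   indexed by the preimage of [y] under [f]. *)
exists (beta ((f^-1)%g y)); first by exists ((f^-1)%g y).
by rewrite biquandle_aut_conj_family// symKV.
Qed.
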